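(* A very general K3 surface $X$ with $\operatorname{NS}(X)=U\oplus D_8(-1)$ admits a birational model as a double cover of $\mathbb P^1_{(s)}\times\mathbb P^1_{(u)}$, given on an affine chart by $$w^2=u^4A_0(s)+u^3A_1(s)+u^2A_2(s)+uA_3(s)+A_4(s),$$ with $$\begin{aligned}A_0(s)&=2H_4s+H_{10},\\ A_1(s)&=s^2+H_4^3+F_4H_4^2+H_4G_8+H_{12},\\ A_2(s)&=(3H_4^2+2F_4H_4+G_8)s+F_6H_4^2+H_4G_{10}+H_{14},\\ A_3(s)&=(3H_4+F_4)s^2+(2F_6H_4+G_{10})s+H_4G_{12}+H_{16},\\ A_4(s)&=s^3+F_6s^2+G_{12}s+H_{18}.\end{aligned}$$
   Context: $U$ is the hyperbolic plane and $D_8(-1)$ the negative definite $D_8$ root lattice. The complex numbers $F_i,G_i,H_i$ are the coefficients in the Weierstrass normal form of $U\oplus D_8(-1)$-polarized K3 surfaces: $X$ is birational to $$y^2=x^3+(u^3+F_4u+F_6)x^2+(G_8u^2+G_{10}u+G_{12})x+H_8u^5+H_{10}u^4+H_{12}u^3+H_{14}u^2+H_{16}u+H_{18},$$ and $H_4$ is a chosen complex number with $H_8=-H_4^2$. (The existence of this normal form for a very general such $X$ is known from earlier work.) *)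

(* Defs.v *)
From HB Require Import structures.
From mathcomp Require Import all_boot all_order all_algebra.
From mathcomp Require Import reals complex mpoly.

Set Implicit Arguments.
Unset Strict Implicit.
Unset Printing Implicit Defensive.

Import Order.TTheory GRing.Theory Num.Theory.
Local Open Scope ring_scope.

(** Geometry over [k : numClosedFieldType], used here only as a name for
    "algebraically closed field of characteristic zero". *)

(** An integral projective variety in P^n, given by its function field K and
    the homogeneous coordinates in K of its generic point.  Its homogeneous
    ideal consists of the forms vanishing at the generic point, and K is
    required to be exactly the field of degree-0 fractions. *)
Record projVar (k : numClosedFieldType) := ProjVar {
  pv_n : nat;
  pv_K : fieldType;
  pv_iota : {rmorphism k -> pv_K};
  pv_gen : 'I_pv_n.+1 -> pv_K;
  pv_neq0 : exists i, pv_gen i != 0;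
  pv_ratio : forall f : pv_K,
    exists (d : nat) (P Q : {mpoly k[pv_n.+1]}),
      [/\ P \is d.-homog, Q \is d.-homog, mmap pv_iota pv_gen Q != 0
        & f = mmap pv_iota pv_gen P / mmap pv_iota pv_gen Q]
}.

Definition gval (k : numClosedFieldType) (X : projVar k)
    (P : {mpoly k[(pv_n X).+1]}) : pv_K X :=
  mmap (pv_iota X) (@pv_gen k X) P.

(** Closed points are handled through their homogeneous coordinate vectors. *)
Definition pv_coord (k : numClosedFieldType) (X : projVar k) : Type :=
  'I_(pv_n X).+1 -> k.

Definition same_point (k : numClosedFieldType) (n : nat)
    (p q : 'I_n -> k) : Prop :=
  exists c : k, c != 0 /\ forall i, q i = c * p i.

Definition is_point (k : numClosedFieldType) (X : projVar k)
    (p : pv_coord X) : Prop :=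
  (exists i, p i != 0) /\
  forall (d : nat) (P : {mpoly k[(pv_n X).+1]}),
    P \is d.-homog -> gval P = 0 -> P.@[p] = 0.

(** The local ring O_{X,p} as a subring of K, its maximal ideal, its units. *)
Definition regular_at (k : numClosedFieldType) (X : projVar k)
    (p : pv_coord X) (f : pv_K X) : Prop :=
  exists (d : nat) (P Q : {mpoly k[(pv_n X).+1]}),
    [/\ P \is d.-homog, Q \is d.-homog, Q.@[p] != 0 & f = gval P / gval Q].

Definition vanishes_at (k : numClosedFieldType) (X : projVar k)
    (p : pv_coord X) (f : pv_K X) : Prop :=
  exists (d : nat) (P Q : {mpoly k[(pv_n X).+1]}),
    [/\ P \is d.-homog, Q \is d.-homog, P.@[p] = 0, Q.@[p] != 0
      & f = gval P / gval Q].

Definition unit_at (k : numClosedFieldType) (X : projVar k)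
    (p : pv_coord X) (f : pv_K X) : Prop :=
  [/\ f != 0, regular_at p f & regular_at p f^-1].

Definition alg_indep (k : numClosedFieldType) (X : projVar k) (m : nat)
    (v : 'I_m -> pv_K X) : Prop :=
  forall P : {mpoly k[m]}, mmap (pv_iota X) v P = 0 -> P = 0.

Definition is_surface (k : numClosedFieldType) (X : projVar k) : Prop :=
  (exists v : 'I_2 -> pv_K X, alg_indep v) /\
  (forall v : 'I_3 -> pv_K X, ~ alg_indep v).

Definition local_parameters (k : numClosedFieldType) (X : projVar k)
    (p : pv_coord X) (s t : pv_K X) : Prop :=
  [/\ vanishes_at p s, vanishes_at p t
    & forall f, vanishes_at p f ->
        exists a b, [/\ regular_at p a, regular_at p b & f = a * s + b * t]].

(** For a surface: every closed point has a regular local ring. *)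
Definition smooth_surface (k : numClosedFieldType) (X : projVar k) : Prop :=
  is_surface X /\
  forall p : pv_coord X, is_point p -> exists s t, local_parameters p s t.

Definition derivation (k : numClosedFieldType) (X : projVar k)
    (D : pv_K X -> pv_K X) : Prop :=
  [/\ forall f g, D (f + g) = D f + D g,
      forall f g, D (f * g) = D f * g + f * D g
    & forall c : k, D (pv_iota X c) = 0].

(** Rational 2-forms, as alternating K-bilinear forms on Der_k(K); only the
    values on derivations matter. *)
Definition rational_2form (k : numClosedFieldType) (X : projVar k)
    (w : (pv_K X -> pv_K X) -> (pv_K X -> pv_K X) -> pv_K X) : Prop :=
  [/\ forall D1 D2 E, derivation D1 -> derivation D2 -> derivation E ->
        w (fun z => D1 z + D2 z) E = w D1 E + w D2 E,
      forall (c : pv_K X) D E, derivation D -> derivation E ->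
        w (fun z => c * D z) E = c * w D E,
      forall D E, derivation D -> derivation E -> w E D = - w D E
    & forall D, derivation D -> w D D = 0].

(** A global section of Omega^2 without zeros: near each point p the form is
    g ds/\dt with s, t local parameters and g = w (d/ds) (d/dt) a unit. *)
Definition trivial_canonical (k : numClosedFieldType) (X : projVar k) : Prop :=
  exists w : (pv_K X -> pv_K X) -> (pv_K X -> pv_K X) -> pv_K X,
    rational_2form w /\
    forall p : pv_coord X, is_point p ->
      exists (s t : pv_K X) (Ds Dt : pv_K X -> pv_K X),
        [/\ local_parameters p s t, derivation Ds /\ derivation Dt,
            Ds s = 1 /\ Ds t = 0, Dt s = 0 /\ Dt t = 1
          & unit_at p (w Ds Dt)].

(** Sections of O_X over the intersection of the standard affine charts
    [X_i != 0] and [X_j != 0]. *)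
Definition regular_on (k : numClosedFieldType) (X : projVar k)
    (i j : 'I_(pv_n X).+1) (f : pv_K X) : Prop :=
  forall p : pv_coord X, is_point p -> p i != 0 -> p j != 0 -> regular_at p f.

(** H^1(X, O_X) = 0, as Cech cohomology of the standard affine cover.
    A chart whose coordinate vanishes identically on X is empty and is left
    out of the cover. *)
Definition H1_structure_sheaf_zero (k : numClosedFieldType) (X : projVar k)
    : Prop :=
  let chart i := @pv_gen k X i != 0 in
  forall f : 'I_(pv_n X).+1 -> 'I_(pv_n X).+1 -> pv_K X,
    (forall i j, chart i -> chart j -> regular_on i j (f i j)) ->
    (forall i j l, chart i -> chart j -> chart l ->
       f i j + f j l = f i l) ->
    exists h : 'I_(pv_n X).+1 -> pv_K X,
      (forall i, chart i -> regular_on i i (h i)) /\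
      (forall i j, chart i -> chart j -> f i j = h j - h i).

Definition K3_surface (k : numClosedFieldType) (X : projVar k) : Prop :=
  [/\ smooth_surface X, trivial_canonical X & H1_structure_sheaf_zero X].

(** Cartier divisors: D p is a local equation at the point p, and the local
    equations at nearby points agree up to units.  The group law is pointwise
    multiplication, and two families differing by units at every point
    represent the same divisor. *)
Definition cartier (k : numClosedFieldType) (X : projVar k)
    (D : pv_coord X -> pv_K X) : Prop :=
  forall p : pv_coord X, is_point p ->
    D p != 0 /\
    exists (d : nat) (Q : {mpoly k[(pv_n X).+1]}),
      [/\ Q \is d.-homog, Q.@[p] != 0
        & forall q : pv_coord X, is_point q -> Q.@[q] != 0 ->
            unit_at q (D q / D p)].

Definition div_add (k : numClosedFieldType) (X : projVar k)
    (D E : pv_coord X -> pv_K X) : pv_coord X -> pv_K X :=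
  fun p => D p * E p.

Definition principal (k : numClosedFieldType) (X : projVar k)
    (D : pv_coord X -> pv_K X) : Prop :=
  exists f : pv_K X,
    f != 0 /\ forall p : pv_coord X, is_point p -> unit_at p (D p / f).

Definition effective (k : numClosedFieldType) (X : projVar k)
    (D : pv_coord X -> pv_K X) : Prop :=
  forall p : pv_coord X, is_point p -> regular_at p (D p).

(** dim_k O_{X,p} / (a, b) = m, by way of a basis e of the quotient. *)
Definition local_mult (k : numClosedFieldType) (X : projVar k)
    (p : pv_coord X) (a b : pv_K X) (m : nat) : Prop :=
  exists e : 'I_m -> pv_K X,
    [/\ forall i, regular_at p (e i),
        forall f, regular_at p f ->
          exists (c : 'I_m -> k) (g h : pv_K X),
            [/\ regular_at p g, regular_at p h
              & f = \sum_(i < m) pv_iota X (c i) * e i + a * g + b * h]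
      & forall (c : 'I_m -> k) (g h : pv_K X),
          regular_at p g -> regular_at p h ->
          \sum_(i < m) pv_iota X (c i) * e i + a * g + b * h = 0 ->
          forall i, c i = 0].

(** D.E = N for effective divisors meeting in finitely many points. *)
Definition proper_intersection (k : numClosedFieldType) (X : projVar k)
    (D E : pv_coord X -> pv_K X) (N : nat) : Prop :=
  exists (r : nat) (p : 'I_r -> pv_coord X) (m : 'I_r -> nat),
    [/\ forall i, is_point (p i),
        forall i j, same_point (p i) (p j) -> i = j,
        forall q : pv_coord X, is_point q ->
          vanishes_at q (D q) -> vanishes_at q (E q) ->
          exists i, same_point (p i) q,
        forall i, local_mult (p i) (D (p i)) (E (p i)) (m i)
      & N = (\sum_(i < r) m i)%N].

(** The intersection pairing: the (unique) symmetric biadditive pairing on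
    divisors which depends only on linear equivalence classes and counts
    intersection points with multiplicity in the proper effective case. *)
Definition intersection_pairing (k : numClosedFieldType) (X : projVar k)
    (I : (pv_coord X -> pv_K X) -> (pv_coord X -> pv_K X) -> int) : Prop :=
  [/\ forall D E, cartier D -> cartier E -> I D E = I E D,
      forall D1 D2 E, cartier D1 -> cartier D2 -> cartier E ->
        I (div_add D1 D2) E = I D1 E + I D2 E,
      forall D E, cartier D -> cartier E -> principal D -> I D E = 0
    & forall D E N, cartier D -> cartier E -> effective D -> effective E ->
        proper_intersection D E N -> I D E = N%:Z].

(** The hyperbolic plane U on Z^2. *)
Definition form_U (a b : 'rV[int]_2) : int := a 0 0 * b 0 1 + a 0 1 * b 0 0.

(** D_8: the vectors of Z^8 with even coordinate sum, with the Euclidean form. *)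
Definition in_D8 (v : 'rV[int]_8) : Prop := (2 %| \sum_i v 0 i)%Z.
Definition form_D8 (v w : 'rV[int]_8) : int := \sum_i v 0 i * w 0 i.

(** NS(X) is isometric to U + D_8(-1).  Here NS(X) = Pic(X), i.e. divisors
    modulo linear equivalence, which is correct for K3 surfaces: there
    H^1(O_X) = 0 makes Pic^0(X) trivial.  The isometry is given as a surjection
    phi from divisors onto the lattice with kernel the principal divisors. *)
Definition NS_is_U_D8neg (k : numClosedFieldType) (X : projVar k) : Prop :=
  exists (I : (pv_coord X -> pv_K X) -> (pv_coord X -> pv_K X) -> int)
         (phi : (pv_coord X -> pv_K X) -> 'rV[int]_2 * 'rV[int]_8),
    intersection_pairing I /\
    [/\ forall D E, cartier D -> cartier E ->
          phi (div_add D E) = phi D + phi E,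
        forall D, cartier D -> in_D8 (phi D).2,
        forall a v, in_D8 v -> exists2 D, cartier D & phi D = (a, v),
        forall D, cartier D -> (phi D = 0 <-> principal D)
      & forall D E, cartier D -> cartier E ->
          I D E = form_U (phi D).1 (phi E).1 - form_D8 (phi D).2 (phi E).2].

Definition irreducible_mpoly (k : numClosedFieldType) (n : nat)
    (g : {mpoly k[n]}) : Prop :=
  [/\ g != 0, g \isn't a GRing.unit
    & forall P Q : {mpoly k[n]},
        g = P * Q -> P \is a GRing.unit \/ Q \is a GRing.unit].

(** X is birational to the affine surface g = 0 in A^3: the latter is an
    integral surface, and mutually inverse regular maps
      p |-> (a_1/a_0, a_2/a_0, a_3/a_0)(p)  and  q |-> [b_0(q) : ... : b_n(q)]
    identify the nonempty open set [h != 0] of X with the open set [c != 0]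
    of the affine surface. *)
Definition birational_affine (k : numClosedFieldType) (X : projVar k)
    (g : {mpoly k[3]}) : Prop :=
  irreducible_mpoly g /\
  exists (d e : nat) (a0 h : {mpoly k[(pv_n X).+1]})
         (a : 'I_3 -> {mpoly k[(pv_n X).+1]})
         (b : 'I_(pv_n X).+1 -> {mpoly k[3]}) (c : {mpoly k[3]}),
    let U (p : pv_coord X) := is_point p /\ h.@[p] != 0 in
    let V (q : 'I_3 -> k) := g.@[q] = 0 /\ c.@[q] != 0 in
    let map_to (p : pv_coord X) : 'I_3 -> k :=
      fun i => (a i).@[p] / a0.@[p] in
    let map_from (q : 'I_3 -> k) : pv_coord X := fun j => (b j).@[q] in
    [/\ [/\ a0 \is d.-homog, forall i, a i \is d.-homog & h \is e.-homog],
        exists p, U p,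
        forall p, U p ->
          [/\ a0.@[p] != 0, V (map_to p) & same_point p (map_from (map_to p))]
      & forall q, V q -> U (map_from q) /\ map_to (map_from q) =1 q].

(** In A^3 with coordinates (u, x, y). *)
Definition weierstrass (k : numClosedFieldType)
    (F4 F6 G8 G10 G12 H8 H10 H12 H14 H16 H18 : k) : {mpoly k[3]} :=
  let u := 'X_0 in let x := 'X_1 in let y := 'X_2 in
  y ^+ 2 - (x ^+ 3
    + (u ^+ 3 + F4 *: u + F6%:MP) * x ^+ 2
    + (G8 *: u ^+ 2 + G10 *: u + G12%:MP) * x
    + H8 *: u ^+ 5 + H10 *: u ^+ 4 + H12 *: u ^+ 3
    + H14 *: u ^+ 2 + H16 *: u + H18%:MP).

(** u^4 A_0(s) + u^3 A_1(s) + u^2 A_2(s) + u A_3(s) + A_4(s) in coordinates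
    (s, u). *)
Definition quartic_in_u (k : numClosedFieldType)
    (A0 A1 A2 A3 A4 : {poly k}) : {mpoly k[2]} :=
  let s := 'X_0 in let u := 'X_1 in
  let at_s (A : {poly k}) : {mpoly k[2]} := (map_poly (@mpolyC 2 k) A).[s] in
  u ^+ 4 * at_s A0 + u ^+ 3 * at_s A1 + u ^+ 2 * at_s A2 + u * at_s A3
    + at_s A4.

(** Bihomogeneous of bidegree (d, e) in (s_0, s_1; u_0, u_1). *)
Definition bihomogeneous (k : numClosedFieldType) (d e : nat)
    (B : {mpoly k[4]}) : Prop :=
  forall m : 'X_{1..4}, m \in msupp B ->
    (m 0%R + m 1%R = d)%N /\ (m 2%R + m 3%R = e)%N.

(** X has as birational model the double cover w^2 = B of P^1 x P^1 (inside
    the total space of O(2,2)), branched along the curve B = 0 of bidegree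
    (4,4), whose chart s_1 = u_1 = 1 is w^2 = f(s, u).  This chart is dense in
    the cover, so that birationality is tested on it; its coordinates are
    (s, u, w). *)
Definition birational_double_cover_P1P1 (k : numClosedFieldType)
    (X : projVar k) (f : {mpoly k[2]}) : Prop :=
  (exists B : {mpoly k[4]},
     [/\ bihomogeneous 4 4 B, B != 0
       & B \mPo [tuple 'X_0; 1; 'X_1; 1] = f]) /\
  birational_affine X ('X_2 ^+ 2 - (f \mPo [tuple 'X_0; 'X_1])).

(* Main.v *)
Require Import Defs.
From HB Require Import structures.
From mathcomp Require Import all_boot all_order all_algebra.
From mathcomp Require Import reals complex mpoly.
From mathcomp Require Import ring.

(** Substituting x = s + H_4 u and y = w in the Weierstrass equation, the u^5
    terms on the right-hand side are (H_4^2 + H_8) u^5: the term u^3 x^2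
    contributes H_4^2 u^5, and no other term involving x reaches that degree.
    The choice H_8 = - H_4^2 therefore makes the right-hand side a quartic in
    u, and collecting the powers of u gives exactly A_0, ..., A_4
    ([weierstrass_shear]).

    The substitution is a linear automorphism of A^3, so it carries the
    Weierstrass surface isomorphically onto the surface w^2 = f(s, u), and a
    birational equivalence with the first surface becomes one with the second
    ([birational_affine_linear]).  Finally every A_i has degree at most 3, so f
    has degree at most 4 in s and in u, and it is the affine part of a form of
    bidegree (4, 4) on P^1 x P^1 ([quartic_in_u_bihomogenization]). *)

Set Implicit Arguments.
Unset Strict Implicit.
Unset Printing Implicit Defensive.

Import Order.TTheory GRing.Theory Num.Theory.
Local Open Scope ring_scope.
Local Open Scope complex_scope.

(** * Linear changes of coordinates *)

(** The substitution v |-> N v; composing a polynomial with it is the pullback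
    along N, so the order of a product of matrices is kept:
    M is substituted first and N afterwards. *)
Definition linear_forms (k : comNzRingType) (n : nat) (N : 'M[k]_n)
    : n.-tuple {mpoly k[n]} :=
  [tuple \sum_j N i j *: 'X_j | i < n].

Lemma meval_linear_forms (k : comNzRingType) (n : nat) (N : 'M[k]_n)
    (g : {mpoly k[n]}) (v : 'I_n -> k) :
  (g \mPo linear_forms N).@[v] = g.@[fun i => \sum_j N i j * v j].
Proof.
rewrite comp_mpoly_meval; apply: meval_eq => i.
rewrite tnth_mktuple raddf_sum; apply: eq_bigr => j _.
by rewrite /= mevalZ mevalXU.
Qed.

Lemma comp_linear_formsM (k : comNzRingType) (n : nat) (M N : 'M[k]_n)
    (g : {mpoly k[n]}) :
  (g \mPo linear_forms M) \mPo linear_forms N = g \mPo linear_forms (M *m N).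
Proof.
rewrite [RHS]comp_mpolyEX [X in X \mPo _]comp_mpolyEX raddf_sum.
apply: eq_bigr => m _ /=.
rewrite comp_mpolyZ !comp_mpolyX rmorph_prod; congr (_ *: _).
apply: eq_bigr => i _ /=; rewrite rmorphXn !tnth_mktuple; congr (_ ^+ _).
rewrite raddf_sum /=.
under eq_bigr do rewrite comp_mpolyZ comp_mpolyXU -tnth_nth tnth_mktuple
  scaler_sumr.
rewrite exchange_big /=; apply: eq_bigr => j _.
by rewrite mxE scaler_suml; apply: eq_bigr => l _; rewrite scalerA.
Qed.

Lemma comp_linear_forms1 (k : comNzRingType) (n : nat) (g : {mpoly k[n]}) :
  g \mPo linear_forms 1%:M = g.
Proof.
rewrite -[RHS]comp_mpoly_id; congr (comp_mpoly _ g).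
apply: eq_from_tnth => i; rewrite !tnth_mktuple (bigD1 i) //= mxE eqxx scale1r.
by rewrite big1 ?addr0 // => j /negPf ji; rewrite mxE eq_sym ji scale0r.
Qed.

Lemma linear_formsK (k : comNzRingType) (n : nat) (M N : 'M[k]_n) :
  M *m N = 1%:M ->
  cancel (comp_mpoly (linear_forms M)) (comp_mpoly (linear_forms N)).
Proof. by move=> MN g; rewrite comp_linear_formsM MN comp_linear_forms1. Qed.

(** Pullback along an invertible matrix is a ring automorphism, hence it
    preserves and reflects units. *)
Lemma irreducible_linear_forms (k : numClosedFieldType) (n : nat)
    (M N : 'M[k]_n) (g : {mpoly k[n]}) :
  M *m N = 1%:M -> irreducible_mpoly g ->
  irreducible_mpoly (g \mPo linear_forms N).
Proof.
move=> MN [g_neq0 g_nunit g_irr].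
have KMN := linear_formsK MN; have KNM := linear_formsK (mulmx1C MN).
have unit_back h : h \mPo linear_forms M \is a GRing.unit ->
    h \is a GRing.unit.
  by move=> /(rmorph_unit (comp_mpoly (linear_forms N))); rewrite /= KMN.
split=> [||P Q gPQ].
- by apply: contraNneq g_neq0 => g0; rewrite -[g]KNM g0 raddf0.
- apply: contra g_nunit.
  by move=> /(rmorph_unit (comp_mpoly (linear_forms M))); rewrite /= KNM.
have: g = (P \mPo linear_forms M) * (Q \mPo linear_forms M).
  by rewrite -rmorphM /= -gPQ KNM.
by case/g_irr => /unit_back; [left | right].
Qed.

(** If g is pulled back along N, its zero set is moved by M = N^-1.  The map
    X --> A^3 is given by fractions a_i / a_0 with a common denominator, so
    applying M to it only mixes the numerators and keeps them homogeneous of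
    degree d.  The inverse map and the open subset [c != 0] are pulled back
    along N. *)
Lemma birational_affine_linear (k : numClosedFieldType) (X : projVar k)
    (M N : 'M[k]_3) (g : {mpoly k[3]}) :
  M *m N = 1%:M -> birational_affine X g ->
  birational_affine X (g \mPo linear_forms N).
Proof.
move=> MN [g_irr [d [e [a0 [h [a [b [c /= [[a0_hom a_hom h_hom] Unon0 XtoV
  VtoX]]]]]]]]].
split; first exact: irreducible_linear_forms MN g_irr.
exists d, e, a0, h, (fun i => \sum_j M i j *: a j),
  (fun j => b j \mPo linear_forms N), (c \mPo linear_forms N).
have NM := mulmx1C MN.
have cancel_mx (A B : 'M[k]_3) (v : 'I_3 -> k) i : A *m B = 1%:M ->
    \sum_j A i j * (\sum_l B j l * v l) = v i.
  move=> AB; under eq_bigr do rewrite mulr_sumr.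
  rewrite exchange_big /= (bigD1 i) //= [X in _ + X]big1 => [|l li].
    have /matrixP/(_ i i) := AB; rewrite !mxE eqxx => ABii.
    under eq_bigr do rewrite mulrA.
    by rewrite -mulr_suml ABii mul1r addr0.
  have /matrixP/(_ i l) := AB; rewrite !mxE eq_sym (negPf li) => ABil.
  under eq_bigr do rewrite mulrA.
  by rewrite -mulr_suml ABil mul0r.
(* The new map X --> A^3 is M applied to the old one. *)
have map_toE p i : (\sum_j M i j *: a j).@[p] / a0.@[p]
    = \sum_j M i j * ((a j).@[p] / a0.@[p]).
  rewrite raddf_sum mulr_suml; apply: eq_bigr => j _.
  by rewrite /= mevalZ mulrA.
have N_map_to p (f : {mpoly k[3]}) :
    (f \mPo linear_forms N).@[fun i => (\sum_j M i j *: a j).@[p] / a0.@[p]]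
    = f.@[fun i => (a i).@[p] / a0.@[p]].
  rewrite meval_linear_forms; apply: meval_eq => i.
  under eq_bigr do rewrite map_toE.
  exact: cancel_mx.
split=> //=.
- split=> // i; apply: rpred_sum => j _; exact: rpredZ.
- move=> p Up; have [a0p [gp cp] [l [l0 pE]]] := XtoV p Up.
  split; [by []|by rewrite !N_map_to|].
  by exists l; split=> // j; rewrite N_map_to pE.
move=> q [gq cq].
have [] := VtoX (fun i => \sum_j N i j * q j).
  by rewrite -!meval_linear_forms; split.
have bE j : (b j).@[fun i => \sum_j0 N i j0 * q j0]
    = (b j \mPo linear_forms N).@[q].
  by rewrite meval_linear_forms.
case=> -[[j bj0] X_ideal] hq q_back; split.
  split; last by rewrite -(meval_eq _ bE).
  split; first by exists j; rewrite -bE.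
  by move=> d' P P_hom PX; rewrite -(meval_eq _ bE); exact: X_ideal P_hom PX.
move=> i; rewrite map_toE -[RHS](cancel_mx _ _ _ _ MN).
apply: eq_bigr => l _; congr (_ * _).
by rewrite -q_back -!(meval_eq _ bE).
Qed.

(** * Bihomogenization *)

Lemma bihomogeneousM (k : numClosedFieldType) d e d' e' (P Q : {mpoly k[4]}) :
  bihomogeneous d e P -> bihomogeneous d' e' Q ->
  bihomogeneous (d + d') (e + e') (P * Q).
Proof.
move=> hP hQ m /msuppM_le /allpairsP[[m1 m2] /= [m1P m2Q ->]].
have [<- <-] := hP _ m1P; have [<- <-] := hQ _ m2Q.
by rewrite !mnmDE; split; rewrite addnACA.
Qed.

Lemma bihomogeneousZ (k : numClosedFieldType) d e c (P : {mpoly k[4]}) :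
  bihomogeneous d e P -> bihomogeneous d e (c *: P).
Proof. by move=> hP m /msuppZ_le /hP. Qed.

Lemma bihomogeneous_sum (k : numClosedFieldType) d e (n : nat)
    (P : 'I_n -> {mpoly k[4]}) :
  (forall i, bihomogeneous d e (P i)) -> bihomogeneous d e (\sum_i P i).
Proof.
move=> hP m /msupp_sum_le; rewrite filter_predT => /flatten_mapP[i _].
exact: hP.
Qed.

Lemma bihomogeneousX_s (k : numClosedFieldType) i j :
  bihomogeneous (i + j) 0 ('X_0 ^+ i * 'X_1 ^+ j : {mpoly k[4]}).
Proof.
move=> m; rewrite !mpolyXn -mpolyXD msuppX inE => /eqP ->.
by rewrite !mnmDE !mulmnE !mnm1E /= !mul0n !mul1n !addn0.
Qed.

Lemma bihomogeneousX_u (k : numClosedFieldType) i j :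
  bihomogeneous 0 (i + j) ('X_2 ^+ i * 'X_3 ^+ j : {mpoly k[4]}).
Proof.
move=> m; rewrite !mpolyXn -mpolyXD msuppX inE => /eqP ->.
by rewrite !mnmDE !mulmnE !mnm1E /= !mul0n !mul1n !addn0.
Qed.

(** On the line u = 0 the quartic restricts to its constant term A_4. *)
Lemma quartic_in_u_eq0 (k : numClosedFieldType) (A0 A1 A2 A3 A4 : {poly k}) :
  quartic_in_u A0 A1 A2 A3 A4 = 0 -> A4 = 0.
Proof.
pose at_u0 : {mpoly k[2]} -> {poly k} := mmap polyC (tnth [tuple 'X; 0]).
move/(congr1 at_u0); rewrite /quartic_in_u /at_u0 !rmorphD /= !rmorphM.
rewrite /= !mmapX !mmap1U /= raddf0.
have -> : tnth [tuple 'X; 0] (1 : 'I_2) = 0 :> {poly k} by [].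
rewrite !mul0r !add0r -horner_map /= mmapX mmap1U.
rewrite -map_poly_comp (eq_map_poly (g := polyC)); last exact: mmapC.
by rewrite [tnth _ _]/(polyX k) -/(_ \Po _) comp_polyXr.
Qed.

(** The form is the sum over i, j <= 4 of the coefficients of s^i u^j times
    s_0^i s_1^(4-i) u_0^j u_1^(4-j); it is nonzero because its restriction to
    the chart s_1 = u_1 = 1 is, thanks to A_4. *)
Lemma quartic_in_u_bihomogenization (k : numClosedFieldType)
    (A0 A1 A2 A3 A4 : {poly k}) :
  all (fun A : {poly k} => size A <= 5)%N [:: A0; A1; A2; A3; A4] ->
  A4 != 0 ->
  exists B : {mpoly k[4]},
    [/\ bihomogeneous 4 4 B, B != 0
      & B \mPo [tuple 'X_0; 1; 'X_1; 1] = quartic_in_u A0 A1 A2 A3 A4].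
Proof.
pose A (j : 'I_5) := [:: A4; A3; A2; A1; A0]`_j => sizeA A4_neq0.
suff [B B_bihom BE] : exists2 B : {mpoly k[4]}, bihomogeneous 4 4 B
    & B \mPo [tuple 'X_0; 1; 'X_1; 1] = quartic_in_u A0 A1 A2 A3 A4.
  exists B; split=> //; apply: contraNneq A4_neq0 => B0.
  by move: BE; rewrite B0 raddf0 => /esym/quartic_in_u_eq0/eqP.
exists (\sum_(j < 5) ('X_2 ^+ j * 'X_3 ^+ (4 - j)) *
         \sum_(i < 5) (A j)`_i *: ('X_0 ^+ i * 'X_1 ^+ (4 - i))).
  apply: bihomogeneous_sum => j; rewrite -[X in bihomogeneous X]add0n.
  rewrite -[X in bihomogeneous _ X]addn0; apply: bihomogeneousM.
    by have := @bihomogeneousX_u k j (4 - j); rewrite subnKC // -ltnS.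
  apply: bihomogeneous_sum => i; apply: bihomogeneousZ.
  by have := @bihomogeneousX_s k i (4 - i); rewrite subnKC // -ltnS.
have dehomog j : (\sum_(i < 5) (A j)`_i *: ('X_0 ^+ i * 'X_1 ^+ (4 - i)))
      \mPo [tuple 'X_0; 1; 'X_1; 1]
    = (map_poly (@mpolyC 2 k) (A j)).['X_0].
  have size_Aj : (size (map_poly (@mpolyC 2 k) (A j)) <= 5)%N.
    apply: leq_trans (size_poly _ _) _.
    case/and5P: sizeA => ? ? ? ? /andP[? _].
    by case: j => -[|[|[|[|[|?]]]]].
  rewrite (horner_coef_wide _ size_Aj) raddf_sum; apply: eq_bigr => i _ /=.
  rewrite comp_mpolyZ rmorphM !rmorphXn /= !comp_mpolyXU /= expr1n mulr1.
  by rewrite coef_map /= mul_mpolyC.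
rewrite raddf_sum /=; under eq_bigr do
  rewrite !rmorphM !rmorphXn /= dehomog !comp_mpolyXU /= expr1n mulr1.
rewrite !big_ord_recr big_ord0 /= /A /= /quartic_in_u.
ring.
Qed.

(** * The shear x = s + H_4 u *)

(** The matrix of (s, u, w) |-> (u, x, y) = (u, s + h u, w). *)
Definition shear (k : comNzRingType) (h : k) : 'M[k]_3 :=
  \matrix_(i, j)
    (nth [::] [:: [:: 0; 1; 0]; [:: 1; h; 0]; [:: 0; 0; 1]] i)`_j.

(** The matrix of (u, x, y) |-> (s, u, w) = (x - h u, u, y). *)
Definition unshear (k : comNzRingType) (h : k) : 'M[k]_3 :=
  \matrix_(i, j)
    (nth [::] [:: [:: - h; 1; 0]; [:: 1; 0; 0]; [:: 0; 0; 1]] i)`_j.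

Lemma unshearK (k : comNzRingType) (h : k) : unshear h *m shear h = 1%:M.
Proof.
apply/matrixP=> -[[|[|[|//]]] ?] -[[|[|[|//]]] ?];
  rewrite !mxE !big_ord_recr big_ord0 /= !mxE /=; ring.
Qed.

Lemma weierstrass_shear (k : numClosedFieldType)
    (F4 F6 G8 G10 G12 H4 H10 H12 H14 H16 H18 : k) :
  weierstrass F4 F6 G8 G10 G12 (- H4 ^+ 2) H10 H12 H14 H16 H18
    \mPo linear_forms (shear H4)
  = 'X_2 ^+ 2 - (quartic_in_u
       ((2 * H4) *: 'X + H10%:P)
       ('X ^+ 2 + (H4 ^+ 3 + F4 * H4 ^+ 2 + H4 * G8 + H12)%:P)
       ((3 * H4 ^+ 2 + 2 * F4 * H4 + G8) *: 'X
          + (F6 * H4 ^+ 2 + H4 * G10 + H14)%:P)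
       ((3 * H4 + F4) *: 'X ^+ 2 + (2 * F6 * H4 + G10) *: 'X
          + (H4 * G12 + H16)%:P)
       ('X ^+ 3 + F6 *: 'X ^+ 2 + G12 *: 'X + H18%:P)
     \mPo [tuple 'X_0; 'X_1]).
Proof.
have -> : linear_forms (shear H4) = [tuple 'X_1; 'X_0 + H4 *: 'X_1; 'X_2].
  apply: eq_from_tnth => -[[|[|[|//]]] lt_i3]; rewrite tnth_mktuple;
    rewrite !big_ord_recr big_ord0 !mxE /= !(tnth_nth 0) /=;
    rewrite ?scale0r ?scale1r ?addr0 ?add0r.
  - by congr (mpolyX _ U_(_)); apply: val_inj.
  - by congr (mpolyX _ U_(_) + _ *: mpolyX _ U_(_)); apply: val_inj.
  - by congr (mpolyX _ U_(_)); apply: val_inj.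
have at_sE (A : {poly k}) :
    (map_poly (@mpolyC 2 k) A).['X_0] \mPo [tuple 'X_0; 'X_1]
    = (map_poly (@mpolyC 3 k) A).['X_0].
  rewrite -horner_map /= comp_mpolyXU -map_poly_comp.
  congr (_.[_]); apply: eq_map_poly => c; exact: comp_mpolyC.
have quarticE (A0 A1 A2 A3 A4 : {poly k}) :
    quartic_in_u A0 A1 A2 A3 A4 \mPo [tuple 'X_0; 'X_1]
    = let at_s (A : {poly k}) := (map_poly (@mpolyC 3 k) A).['X_0] in
      'X_1 ^+ 4 * at_s A0 + 'X_1 ^+ 3 * at_s A1 + 'X_1 ^+ 2 * at_s A2
      + 'X_1 * at_s A3 + at_s A4.
  rewrite /quartic_in_u !rmorphD /= !(rmorphM (comp_mpoly _)) /= !at_sE.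
  by rewrite !comp_mpolyXU /=.
rewrite {}quarticE /weierstrass /=.
pose at_s (A : {poly k}) := (map_poly (@mpolyC 3 k) A).['X_0].
rewrite -!/(at_s _).
have at_sD A B : at_s (A + B) = at_s A + at_s B.
  by rewrite /at_s rmorphD hornerD.
have at_sZ c A : at_s (c *: A) = c%:MP * at_s A.
  by rewrite /at_s map_polyZ hornerZ.
have at_sC c : at_s c%:P = c%:MP by rewrite /at_s map_polyC hornerC.
have at_sX : at_s 'X = 'X_0 by rewrite /at_s map_polyX hornerX.
have at_sXn n : at_s ('X ^+ n) = 'X_0 ^+ n.
  by rewrite /at_s map_polyXn hornerXn.
rewrite !(at_sD, at_sZ, at_sC, at_sX, at_sXn).
rewrite -!mul_mpolyC comp_mpolyB.
do 2!rewrite !(comp_mpolyD, rmorphXn (comp_mpoly _), rmorphM (comp_mpoly _)) /=.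
rewrite !comp_mpolyXU !comp_mpolyC /=.
have mpolyCX c n : (c ^+ n)%:MP = c%:MP ^+ n :> {mpoly k[3]}.
  exact: rmorphXn.
rewrite !(mpolyC_nat, mpolyCD, mpolyCN, mpolyCX, mpolyCM).
ring.
Qed.

Theorem proposition4p3 (R : realType) (X : projVar R[i])
    (F4 F6 G8 G10 G12 H4 H8 H10 H12 H14 H16 H18 : R[i])
    (X_K3 : K3_surface X)
    (X_NS : NS_is_U_D8neg X)
    (X_normal_form : birational_affine X
       (weierstrass F4 F6 G8 G10 G12 H8 H10 H12 H14 H16 H18))
    (H8E : H8 = - H4 ^+ 2) :
  birational_double_cover_P1P1 X
    (quartic_in_u
       ((2 * H4) *: 'X + H10%:P)
       ('X ^+ 2 + (H4 ^+ 3 + F4 * H4 ^+ 2 + H4 * G8 + H12)%:P)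
       ((3 * H4 ^+ 2 + 2 * F4 * H4 + G8) *: 'X
          + (F6 * H4 ^+ 2 + H4 * G10 + H14)%:P)
       ((3 * H4 + F4) *: 'X ^+ 2 + (2 * F6 * H4 + G10) *: 'X
          + (H4 * G12 + H16)%:P)
       ('X ^+ 3 + F6 *: 'X ^+ 2 + G12 *: 'X + H18%:P)).
Proof.
split; last first.
  rewrite -weierstrass_shear; apply: (birational_affine_linear (unshearK H4)).
  by rewrite -H8E.
have size_leD (p q : {poly R[i]}) :
    (size p <= 5 -> size q <= 5 -> size (p + q)%R <= 5)%N.
  by move=> p5 q5; rewrite (leq_trans (size_polyD _ _)) // geq_max p5.
apply: quartic_in_u_bihomogenization.
  by rewrite /= !size_leD // ?(leq_trans (size_scale_leq _ _)) ?size_polyXn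
    ?size_polyX ?(leq_trans (size_polyC_leq1 _)).
(* A_4 is a monic cubic in s. *)
apply/eqP => /(congr1 (coefp 3)) /=; rewrite !coefE /= !mulr0 !addr0.
by move/eqP; rewrite oner_eq0.
Qed.
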